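(* Let $M$ be a loopless matroid on $E=\{0,\dots,n\}$ of rank $d+1$, and let $A_1,\dots,A_d$ be nonempty subsets of $E$. Then \[M\wedge H_{A_1}\wedge\cdots\wedge H_{A_d}=U_{1,E}\iff \{A_1,\dots,A_d\}\text{ satisfies }\operatorname{DHR}(M).\] Consequently, \[\int_M h_{A_1}(M)\cdots h_{A_d}(M)=\begin{cases}1&\text{if }\{A_1,\dots,A_d\}\text{ satisfies }\operatorname{DHR}(M),\\0&\text{otherwise.}\end{cases}\]
   Context: For nonempty $S\subseteq E$, $H_S$ is the matroid on $E$ with bases $\{E\setminus i: i\in S\}$. $M\wedge N$ is the matroid on $E$ whose spanning sets are $\{S\cap S': S\text{ spanning in }M,\ S'\text{ spanning in }N\}$; $U_{1,E}$ is the uniform matroid of rank $1$ on $E$. The family $\{A_1,\dots,A_d\}$ satisfies the dragon Hall–Rado condition $\operatorname{DHR}(M)$ if $\operatorname{rk}_M(\bigcup_{j\in J}A_j)\ge|J|+1$ for every nonempty $J\subseteq\{1,\dots,d\}$. The Chow ring $A^\bullet(M)=\mathbb R[x_F: F\text{ nonempty proper flat}]/(\langle x_Fx_{F'}: F,F'\text{ incomparable}\rangle+\langle\sum_{F\ni i}x_F-\sum_{F\ni j}x_F\rangle)$, with degree map $\int_M:A^d(M)\to\mathbb R$ given by $\int_M x_{F_1}\cdots x_{F_d}=1$ for maximal chains of nonempty proper flats. For nonempty $S\subseteq E$, $h_S(M)=\alpha-\sum_{G}x_G\in A^1(M)$, where $G$ ranges over proper flats containing $S$ and $\alpha=\sum_{F\ni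 i}x_F$ for any $i\in E$ (equivalently, in the Feichtner–Yuzvinsky variables, $h_S(M)=-\sum_{G\supseteq S}z_G$ over all flats $G\supseteq S$ including $E$, with $z_E=-\alpha$). *)

(* Defs.v *)
From HB Require Import structures.
From mathcomp Require Import all_boot all_order all_algebra.
Set Implicit Arguments. Unset Strict Implicit. Unset Printing Implicit Defensive.
Import Order.TTheory GRing.Theory Num.Theory.

(* A matroid on the finite ground set T is given by its family of bases. *)
Section Matroids.
Variable T : finType.
Implicit Types (B : {set {set T}}) (S : {set T}).

Definition is_matroid B : Prop :=
  B != set0 /\
  (forall B1 B2 : {set T}, B1 \in B -> B2 \in B -> forall x, x \in B1 :\: B2 ->
     exists2 y, y \in B2 :\: B1 & (B1 :\ x) :|: [set y] \in B).

Definition mrank B S : nat := \max_(b in B) #|S :&: b|.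

Definition loopless B : Prop := forall i : T, mrank B [set i] = 1%N.

Definition is_flat B (F : {set T}) : bool :=
  [forall x, (x \notin F) ==> (mrank B F < mrank B (x |: F))%N].

Definition nepflat B (F : {set T}) : bool :=
  [&& F != set0, F != setT & is_flat B F].

Definition spanning B : {set {set T}} :=
  [set X : {set T} | [exists b in B, b \subset X]].

(* M /\ N on spanning-set families: spanning sets are S :&: S' *)
Definition meetf (S1 S2 : {set {set T}}) : {set {set T}} :=
  [set X :&: Y | X in S1, Y in S2].

Definition H_bases S : {set {set T}} := [set ~: [set i] | i in S].

Definition U1_bases : {set {set T}} := [set [set i] | i : T].

Definition max_chain B (s : seq {set T}) : Prop :=
  [/\ all (nepflat B) s,
      sorted (fun F G : {set T} => F \proper G) s &
      forall G, nepflat B G ->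
        (forall F, F \in s -> (F \subset G) || (G \subset F)) -> G \in s].
End Matroids.

Definition meet_all (T : finType) (d : nat) (B : {set {set T}})
    (A : 'I_d -> {set T}) : {set {set T}} :=
  foldl (fun S k => meetf S (spanning (H_bases (A k)))) (spanning B) (enum 'I_d).

Definition DHR (T : finType) (d : nat) (B : {set {set T}}) (A : 'I_d -> {set T}) : bool :=
  [forall J : {set 'I_d}, (J != set0) ==>
     (#|J|.+1 <= mrank B (\bigcup_(j in J) A j))%N].

Local Open Scope ring_scope.

(* Linear functionals on the degree-d part A^d(M) of the Chow ring.
   A linear form on Sym^d(span {x_F}) is a function phi on monomials
   x_{F_1}...x_{F_d}, encoded as (order-irrelevant) sequences of nonempty proper
   flats.  It descends to A^d(M) = Sym^d / I_d iff it kills the degree-d part of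
   the ideal, i.e. all monomial multiples of the (homogeneous) generators.
   The degree map int_M is such a functional with value 1 on maximal chains. *)
Definition is_degree_map (R : ringType) (n d : nat) (B : {set {set 'I_n.+1}})
    (phi : seq {set 'I_n.+1} -> R) : Prop :=
  [/\ (forall s t, size s = d -> all (nepflat B) s -> perm_eq s t -> phi s = phi t),
      (forall s, size s = d -> all (nepflat B) s ->
         (exists F G, [/\ F \in s, G \in s, ~~ (F \subset G) & ~~ (G \subset F)]) ->
         phi s = 0),
      (forall (i j : 'I_n.+1) (t : seq {set 'I_n.+1}), (size t).+1 = d ->
         all (nepflat B) t ->
         \sum_(F : {set 'I_n.+1} | nepflat B F && (i \in F)) phi (F :: t) =
         \sum_(F : {set 'I_n.+1} | nepflat B F && (j \in F)) phi (F :: t)) &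
      (forall s, size s = d -> max_chain B s -> phi s = 1)].

(* value of phi on the product l_1 * ... * l_d of linear forms
   l_k = sum_F (l k F) x_F  (F over nonempty proper flats) *)
Definition chow_eval (R : ringType) (n d : nat) (B : {set {set 'I_n.+1}})
    (phi : seq {set 'I_n.+1} -> R) (l : 'I_d -> {set 'I_n.+1} -> R) : R :=
  \sum_(f : {ffun 'I_d -> {set 'I_n.+1}} | [forall k, nepflat B (f k)])
     (\prod_(k < d) l k (f k)) * phi [seq f k | k <- enum 'I_d].

(* h_S(M) = alpha - sum_{G proper flat, S \subset G} x_G, alpha = sum_{F \ni 0} x_F;
   coefficient of x_F *)
Definition h_coef (R : ringType) (n : nat) (S F : {set 'I_n.+1}) : R :=
  (if (ord0 : 'I_n.+1) \in F then 1 else 0) - (if S \subset F then 1 else 0).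

(* Main.v *)
(** Truncating the matroid of rank function [r] along [a], i.e. replacing it by
    [r' X = r X - 1] when [a] lies in the closure of [X] and [r' X = r X]
    otherwise, computes [M /\ H_a].  On the Chow side, if [r a >= 2] and [phi] is a
    degree map of [r], then [s |-> phi (h_a * x_s)] is a degree map of [r']: for [i]
    in [a], [h_a] is the sum of the [x_F] with [i \in F] and [~ a \subset F], which
    kills the flats of [r] that are not flats of [r'], and extends a maximal chain
    of [r'] to a maximal chain of [r] in exactly one way.  If [r a = 1] then
    [h_a = 0], while [M /\ H_a] has a loop.  Hence both sides of the theorem
    reduce, one set at a time, to the recursion [dhr], which unfolds to the dragon
    Hall-Rado condition. *)
Require Import Defs.
From HB Require Import structures.
From mathcomp Require Import all_boot all_order all_algebra zify.
Import Order.TTheory GRing.Theory Num.Theory.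
Local Open Scope ring_scope.

Set Implicit Arguments.
Unset Strict Implicit.
Unset Printing Implicit Defensive.

(** * From bases to rank functions *)

Definition is_rank (T : finType) (r : {set T} -> nat) : Prop :=
  [/\ forall X : {set T}, (r X <= #|X|)%N,
      forall X Y : {set T}, X \subset Y -> (r X <= r Y)%N &
      forall X Y : {set T}, (r (X :|: Y) + r (X :&: Y) <= r X + r Y)%N].

Section BasesToRank.
Local Open Scope nat_scope.
Variables (T : finType) (B : {set {set T}}).
Hypothesis matB : is_matroid B.

(** The last two conjuncts drive inductions on [#|b1 :\: b2|]: exchange moves [b1] towards [b2]
    without changing its size. *)
Lemma basis_exchange (b1 b2 : {set T}) x :
  b1 \in B -> b2 \in B -> x \in b1 -> x \notin b2 ->
  exists y, [/\ y \in b2, y \notin b1, y |: (b1 :\ x) \in B,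
    #|y |: (b1 :\ x)| = #|b1| & #|(y |: (b1 :\ x)) :\: b2| < #|b1 :\: b2| ].
Proof.
move=> B1 B2 x1 x2; have [_ /(_ b1 b2 B1 B2 x)] := matB.
rewrite inE x1 x2 => /(_ isT) [y]; rewrite inE => /andP[y1 y2] yB.
exists y; split=> //; first by rewrite setUC.
  by rewrite cardsU1 !inE negb_and y1 orbT (cardsD1 x b1) x1.
rewrite (cardsD1 x (b1 :\: b2)) !inE x1 x2 add1n ltnS; apply: subset_leq_card.
apply/subsetP => z; rewrite !inE => /andP[z2 /orP[/eqP zy|/andP[-> ->]]].
  by rewrite zy y2 in z2.
by rewrite z2.
Qed.

Lemma leq_card_bases (b1 b2 : {set T}) : b1 \in B -> b2 \in B -> #|b1| <= #|b2|.
Proof.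
move: {2}#|_ :\: _|.+1 (ltnSn #|b1 :\: b2|) => k.
elim: k b1 => // k IH b1 lek B1 B2.
have [/subset_leq_card //|/subsetPn[x x1 x2]] := boolP (b1 \subset b2).
have [y [y2 y1 yB <- lt]] := basis_exchange B1 B2 x1 x2.
by apply: IH => //; apply: leq_trans lt _.
Qed.

Lemma card_bases (b1 b2 : {set T}) : b1 \in B -> b2 \in B -> #|b1| = #|b2|.
Proof. by move=> B1 B2; apply/eqP; rewrite eqn_leq !leq_card_bases. Qed.

Lemma leq_mrank (b X : {set T}) : b \in B -> #|X :&: b| <= mrank B X.
Proof. by move=> bB; apply: (@leq_bigmax_cond _ _ (fun b => #|X :&: b|)). Qed.

Lemma mrank_witness (X : {set T}) : exists2 b, b \in B & mrank B X = #|X :&: b|.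
Proof.
have [B0 _] := matB.
have /(eq_bigmax_cond (fun b => #|X :&: b|)) [b bB e] : 0 < #|B|.
  by rewrite card_gt0.
by exists b.
Qed.

(** One basis serving both sets is what submodularity needs. Starting from a basis optimal for [U],
    exchanges towards one optimal for [V] delete only elements outside [V], so nothing is lost on
    [U]. *)
Lemma mrank_witness2 (U V : {set T}) : U \subset V ->
  exists b, [/\ b \in B, #|U :&: b| = mrank B U & #|V :&: b| = mrank B V].
Proof.
move=> UV; have [b1 B1 e1] := mrank_witness U; have [b2 B2 e2] := mrank_witness V.
move: {2}#|_ :\: _|.+1 (ltnSn #|b1 :\: b2|) => k.
elim: k b1 B1 e1 => // k IH b1 B1 e1 lek.
have [lt12|ge12] := ltnP #|V :&: b1| #|V :&: b2|; last first.
  by exists b1; split=> //; apply/eqP; rewrite eqn_leq leq_mrank //= e2.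
(* Bases have equal size, so [b1], meeting [V] in fewer elements than [b2], has more elements
   outside [V]. *)
have [x xb1 /andP[xV xb2]] : exists2 x, x \in b1 & (x \notin V) && (x \notin b2).
  have : #|b2 :\: V| < #|b1 :\: V|.
    have := cardsID V b1; have := cardsID V b2.
    have := card_bases B1 B2; rewrite ![_ :&: V]setIC; lia.
  rewrite ltnNge => /negP h.
  have [/subset_leq_card //|/subsetPn[x]] := boolP (b1 :\: V \subset b2 :\: V).
  rewrite !inE => /andP[xV x1]; rewrite xV /= => x2.
  by exists x; rewrite ?xV.
have [y [y2 y1 yB _ lt]] := basis_exchange B1 B2 xb1 xb2.
apply: (IH _ yB); last exact: leq_trans lt _.
apply/eqP; rewrite eqn_leq leq_mrank // andbT e1; apply: subset_leq_card.
apply/subsetP => z; rewrite !inE => /andP[zU ->]; rewrite zU andbT /=.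
by case: (z =P x) => [zx|]; rewrite ?orbT //; rewrite -zx (subsetP UV) in xV.
Qed.

Lemma mrank_is_rank : is_rank (mrank B).
Proof.
split=> [X|X Y XY|X Y].
- by apply/bigmax_leqP => b _; apply/subset_leq_card/subsetIl.
- have [b bB ->] := mrank_witness X.
  by apply: leq_trans (leq_mrank Y bB); apply/subset_leq_card/setSI.
- have [|b [bB <- <-]] := @mrank_witness2 (X :&: Y) (X :|: Y).
    exact: subset_trans (subsetIl _ _) (subsetUl _ _).
  have := leq_mrank X bB; have := leq_mrank Y bB.
  have := cardsUI (X :&: b) (Y :&: b); rewrite -setIUl setIACA setIid; lia.
Qed.

Lemma spanningE (X : {set T}) : (X \in spanning B) = (mrank B X == mrank B setT).
Proof.
have [b bB eT] := mrank_witness setT; rewrite setTI in eT.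
rewrite inE; apply/idP/eqP => [/existsP[c /andP[cB cX]]|].
  have := leq_mrank X cB; rewrite (setIidPr cX) => h.
  apply/eqP; rewrite eqn_leq eT -(card_bases cB bB) h andbT.
  by have [_ mon _] := mrank_is_rank; rewrite (card_bases cB bB) -eT mon.
have [c cB ->] := mrank_witness X; rewrite eT (card_bases bB cB) => e.
apply/existsP; exists c; rewrite cB /=.
by apply/setIidPr/eqP; rewrite eqEcard subsetIr e /=.
Qed.
End BasesToRank.

(** * Rank functions, flats and closure *)

Section RankFunctions.
Local Open Scope nat_scope.
Variable T : finType.
Implicit Types (r : {set T} -> nat) (X Y F H : {set T}).

Definition rflat r F : bool := [forall x, (x \notin F) ==> (r F < r (x |: F))].

Definition proper_flat r F : bool := [&& F != set0, F != setT & rflat r F].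

Definition rclosure r X : {set T} := [set x | r (x |: X) == r X].

Variable r : {set T} -> nat.
Hypothesis rk : is_rank r.

Lemma rank_card X : r X <= #|X|. Proof. by case: rk. Qed.
Lemma rankS X Y : X \subset Y -> r X <= r Y. Proof. by case: rk => _ h _; apply: h. Qed.
Lemma rank_submod X Y : r (X :|: Y) + r (X :&: Y) <= r X + r Y.
Proof. by case: rk. Qed.

(** Submodularity for [Y] and [X :|: Z]: the gain from adding [Z] shrinks as the set grows. With
    [Z = a], the sets spanning [a] are closed upwards. *)
Lemma rank_diminishing X Y Z : X \subset Y -> r (Y :|: Z) + r X <= r Y + r (X :|: Z).
Proof.
move=> XY; have := rank_submod Y (X :|: Z).
have -> : Y :|: (X :|: Z) = Y :|: Z by rewrite setUA (setUidPl XY).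
have : r X <= r (Y :&: (X :|: Z)) by apply: rankS; rewrite subsetI XY subsetUl.
lia.
Qed.

Lemma rank_spanned_mono X Y Z : X \subset Y -> r (X :|: Z) = r X -> r (Y :|: Z) = r Y.
Proof.
by move=> XY; have := rank_diminishing Z XY; have := rankS (subsetUl Y Z); lia.
Qed.

Lemma rankU1 x X : r (x |: X) <= (r X).+1.
Proof.
have := rank_submod [set x] X; have := rank_card [set x]; rewrite cards1; lia.
Qed.

Lemma rank_setD X Y : r X <= r Y + #|X :\: Y|.
Proof.
have := rank_submod Y (X :\: Y); have := rank_card (X :\: Y).
have : r X <= r (Y :|: (X :\: Y)).
  by apply: rankS; apply/subsetP => x; rewrite !inE => ->; case: (x \in Y).
lia.
Qed.

Lemma rank_spanned X Y : {in Y, forall x, r (x |: X) = r X} -> r (X :|: Y) = r X.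
Proof.
move=> h; have {h} : {in enum Y, forall x, r (x |: X) = r X}.
  by move=> x; rewrite mem_enum; apply: h.
rewrite -[Y in _ :|: Y]set_enum.
elim: (enum Y) => [|y s IH] h.
  by rewrite set_nil setU0.
rewrite set_cons [y |: _]setUC setUA (@rank_spanned_mono X); first 1 last.
- exact: subsetUl.
- by rewrite setUC; apply: h; rewrite inE eqxx.
by apply: IH => x xs; apply: h; rewrite inE xs orbT.
Qed.

Lemma rflatP F : reflect (forall x, x \notin F -> r (x |: F) = (r F).+1) (rflat r F).
Proof.
apply: (iffP forallP) => h x; last first.
  by apply/implyP => /h ->.
move=> xF; apply/eqP; rewrite eqn_leq rankU1 /=.
by move/implyP: (h x); apply.
Qed.

Lemma flat_absorb F X : rflat r F -> r (F :|: X) = r F -> X \subset F.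
Proof.
move=> /rflatP cF e; apply/subsetP => x xX; apply: contraT => /cF.
have : r (x |: F) <= r (F :|: X) by apply: rankS; rewrite setUC setUS // sub1set.
lia.
Qed.

Lemma flat_rank_eq F H : rflat r F -> F \subset H -> r H <= r F -> F = H.
Proof.
move=> cF FH le; apply/eqP; rewrite eqEsubset FH; apply: (flat_absorb cF).
by rewrite (setUidPr FH); apply/eqP; rewrite eqn_leq le rankS.
Qed.

Lemma sub_closure X : X \subset rclosure r X.
Proof.
apply/subsetP => x xX; rewrite inE; apply/eqP; congr r.
by apply/setUidPr; rewrite sub1set.
Qed.

Lemma rank_closure X : r (rclosure r X) = r X.
Proof.
rewrite -[in RHS](@rank_spanned X (rclosure r X)) ?(setUidPr (sub_closure X)) //.
by move=> x; rewrite inE => /eqP.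
Qed.

Lemma closure_flat X : rflat r (rclosure r X).
Proof.
apply/forallP => x; apply/implyP; rewrite rank_closure inE => h.
apply: (@leq_trans (r (x |: X))); last by rewrite rankS ?setUS ?sub_closure.
by rewrite ltn_neqAle eq_sym h rankS ?subsetUr.
Qed.

Lemma closure_sub X F : rflat r F -> X \subset F -> rclosure r X \subset F.
Proof.
move=> cF XF; apply: (flat_absorb cF); apply: rank_spanned => x.
by rewrite inE ![x |: _]setUC => /eqP; apply: rank_spanned_mono.
Qed.

Lemma flat_setT : rflat r setT.
Proof. by apply/forallP => x; rewrite inE. Qed.

(** * Truncation along a set *)

Section Trunc.
Variable a : {set T}.

(* For [0 < r a]; if [r a = 0] the subtraction is truncated when [r X = 0]. *)
Definition trunc X : nat := r X - (r (X :|: a) == r X).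

Lemma trunc_le X : trunc X <= r X. Proof. exact: leq_subr. Qed.

Hypothesis ra : 0 < r a.

Lemma truncP X :
  (r (X :|: a) = r X /\ (trunc X).+1 = r X) \/ (r X < r (X :|: a) /\ trunc X = r X).
Proof.
rewrite /trunc; have := rankS (subsetUl X a); have := rankS (subsetUr X a).
by case: eqP; lia.
Qed.

Lemma trunc_setU X : (trunc (X :|: a)).+1 = r (X :|: a).
Proof. by case: (truncP (X :|: a)); rewrite -setUA setUid; lia. Qed.

(** Submodularity of [r] on [X] and [Y] suffices unless both span [a] while [X :&: Y] does not; then
    submodularity on [X :|: a] and [Y :|: a] gives the missing unit. *)
Lemma trunc_is_rank : is_rank trunc.
Proof.
split=> [X|X Y XY|X Y].
- exact: leq_trans (trunc_le X) (rank_card X).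
- have := rankS XY; have := rank_diminishing a XY.
  have := rankS (setSU a XY).
  by case: (truncP X); case: (truncP Y); lia.
- have := rank_submod X Y; have := rank_submod (X :|: a) (Y :|: a).
  rewrite -setUIl setUACA setUid.
  have := rank_diminishing a (subsetUl X Y); have := rank_diminishing a (subsetUr X Y).
  have := rank_diminishing a (subsetIl X Y); have := rank_diminishing a (subsetIr X Y).
  case: (truncP X); case: (truncP Y); case: (truncP (X :|: Y)); case: (truncP (X :&: Y));
  lia.
Qed.
End Trunc.
End RankFunctions.

(** Maximal chains listed in any order, so that a new member can be put at the head. *)
Definition saturated (T : finType) (r : {set T} -> nat) (s : seq {set T}) : Prop :=
  [/\ uniq s, all (proper_flat r) s,
      {in s &, forall F G : {set T}, (F \subset G) || (G \subset F)} &
      forall G, proper_flat r G ->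
        {in s, forall F : {set T}, (F \subset G) || (G \subset F)} -> G \in s].

(** * Flats and maximal chains of a truncation *)

Section TruncFlats.
Local Open Scope nat_scope.
Variables (T : finType) (r : {set T} -> nat) (a : {set T}).
Hypotheses (rk : is_rank r) (ra : 0 < r a).
Implicit Types F G H : {set T}.

(* The closure of [F :|: a] covers [F], so it is contained in every flat [H]
   that contains [F] and some [i] in [a :\: F]. *)
Lemma cover_absorb F H i : rflat r F -> rflat r H ->
  r (F :|: a) = (r F).+1 -> i \in a -> i \notin F -> i \in H -> F \subset H ->
  a \subset H.
Proof.
move=> cF cH e ia iF iH FH; apply: (flat_absorb rk cH).
apply: (rank_spanned_mono rk (X := i |: F)); first by rewrite subUset sub1set iH.
rewrite -setUA (setUidPr _) ?sub1set ?inE ?ia ?orbT // e.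
by rewrite (rflatP rk _ cF).
Qed.

(** If [r (F :|: a) = (r F).+1], adding any [i] in [a :\: F] raises [r] by one but brings [a] into
    the closure, so [trunc r a] does not grow. For other flats, [a] is already in [F], or is at
    least two ranks away and one point cannot absorb it. *)
Lemma flat_truncE F :
  rflat (trunc r a) F = rflat r F && (r (F :|: a) != (r F).+1).
Proof.
have rk' := trunc_is_rank rk ra.
apply/idP/andP => [c'|[cF ne]].
  have cF : rflat r F.
    apply/(rflatP rk) => x xF; have := rflatP rk' _ c' _ xF.
    have := rank_diminishing rk a (subsetUr [set x] F).
    have := rankS rk (subsetUr [set x] F).
    have := rankS rk (setSU a (subsetUr [set x] F)).
    have := rankU1 rk x F.
    by case: (truncP rk ra F); case: (truncP rk ra (x |: F)); lia.
  split=> //; apply/eqP => e.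
  have /subsetPn[i ia iF] : ~~ (a \subset F).
    by apply/negP => /setUidPl eF; rewrite eF in e; lia.
  have := rflatP rk' _ c' _ iF; have := rflatP rk _ cF _ iF.
  have : i |: F :|: a = F :|: a.
    by rewrite [i |: F]setUC -setUA; congr (_ :|: _); apply/setUidPr; rewrite sub1set.
  by case: (truncP rk ra F); case: (truncP rk ra (i |: F));
    move=> [h1 h2] [h3 h4] h5; rewrite h5 in h1; lia.
apply/(rflatP rk') => x xF; have e := rflatP rk _ cF _ xF.
have := rank_diminishing rk a (subsetUr [set x] F).
have := rankS rk (setSU a (subsetUr [set x] F)).
have := rankS rk (subsetUl F a).
by case: (truncP rk ra F); case: (truncP rk ra (x |: F)); lia.
Qed.

Lemma proper_flat_truncE F :
  proper_flat (trunc r a) F = proper_flat r F && (r (F :|: a) != (r F).+1).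
Proof. by rewrite /proper_flat flat_truncE -!andbA. Qed.

Lemma flat_trunc_sup F : rflat r F -> a \subset F -> rflat (trunc r a) F.
Proof.
by move=> cF /setUidPl aF; rewrite flat_truncE cF aF neq_ltn ltnSn.
Qed.

Lemma flat_trunc_rank F : rflat (trunc r a) F -> ~~ (a \subset F) ->
  (r F).+1 < r (F :|: a).
Proof.
rewrite flat_truncE => /andP[cF /eqP ne] aF.
have := rankS rk (subsetUl F a).
have : r (F :|: a) <> r F by move=> /(flat_absorb rk cF); apply/negP.
lia.
Qed.

Lemma flat0 : (forall x, r [set x] = 1) -> rflat r set0.
Proof.
move=> ll; apply/(rflatP rk) => x _; rewrite setU0 ll.
by have := rank_card rk set0; rewrite cards0; lia.
Qed.

Lemma saturated_lift s : (forall x, r [set x] = 1) -> 1 < r a ->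
  saturated (trunc r a) s ->
  exists i H0, [/\ i \in a, i \in H0, ~~ (a \subset H0), saturated r (H0 :: s) &
    forall H, proper_flat r H -> i \in H -> ~~ (a \subset H) ->
      {in s, forall F, (F \subset H) || (H \subset F)} -> H = H0].
Proof.
move=> ll ra1 [us cs ts ms]; pose s0 := set0 :: setT :: s.
have r0 : r set0 = 0 by have := rank_card rk set0; rewrite cards0; lia.
have a0 : ~~ (a \subset set0).
  by apply/negP; rewrite subset0 => /eqP e; rewrite e r0 in ra1.
(* [set0] stays a flat of the truncation because [r a] differs from [(r set0).+1 = 1]. *)
have cs0 F : F \in s0 -> rflat (trunc r a) F.
  rewrite !inE => /or3P[/eqP->|/eqP->|/(allP cs)/and3P[] //].
    by rewrite flat_truncE flat0 // set0U r0; apply/eqP; lia.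
  exact: flat_setT.
have cmp0 H : {in s, forall F, (F \subset H) || (H \subset F)} ->
    {in s0, forall F, (F \subset H) || (H \subset F)}.
  move=> h F; rewrite !inE => /or3P[/eqP->|/eqP->|/h //].
    by rewrite sub0set.
  by rewrite subsetT orbT.
have ts0 F G : F \in s0 -> G \in s0 -> (F \subset G) || (G \subset F).
  move=> Fs Gs; apply: (cmp0 G) => // {Fs}F Fs; rewrite orbC.
  by apply: (cmp0 F) => // {Gs}G Gs; apply: ts.
(* [L] and [U] are the consecutive members of the chain, completed with the
   improper flats, between which [a] gets absorbed; the new member is the
   closure [H0] of [i |: L], and it is covered by [U]. *)
have [L [Ls aL Lmax]] : exists L : {set T}, [/\ L \in s0, ~~ (a \subset L) &
    forall F, F \in s0 -> ~~ (a \subset F) -> F \subset L].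
  case: (@arg_maxnP _ set0 (fun F => (F \in s0) && ~~ (a \subset F)) (fun F => #|F|)).
    by rewrite inE eqxx a0.
  move=> L /andP[Ls aL] h; exists L; split=> // F Fs aF.
  case/orP: (ts0 _ _ Fs Ls) => // LF.
  suff /eqP <- : L == F by [].
  by rewrite eqEcard LF; apply: h; rewrite Fs.
have [U [Us aU Umin]] : exists U : {set T}, [/\ U \in s0, a \subset U &
    forall F, F \in s0 -> a \subset F -> U \subset F].
  case: (@arg_minnP _ setT (fun F => (F \in s0) && (a \subset F)) (fun F => #|F|)).
    by rewrite !inE eqxx orbT subsetT.
  move=> U /andP[Us aU] h; exists U; split=> // F Fs aF.
  case/orP: (ts0 _ _ Us Fs) => // FU.
  suff /eqP <- : F == U by [].
  by rewrite eqEcard FU; apply: h; rewrite Fs.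
have [i ia iL] := subsetPn aL.
have rLa := flat_trunc_rank (cs0 _ Ls) aL.
have cL : rflat r L by have := cs0 _ Ls; rewrite flat_truncE => /andP[].
have cU : rflat r U by have := cs0 _ Us; rewrite flat_truncE => /andP[].
have LU : L \subset U.
  case/orP: (ts0 _ _ Ls Us) => // UL.
  by rewrite (subset_trans aU UL) in aL.
have [H0 [cH0 iLH0 rH0 H0min]] : exists H0, [/\ rflat r H0, i |: L \subset H0,
    r H0 = (r L).+1 & forall K, rflat r K -> i |: L \subset K -> H0 \subset K].
  exists (rclosure r (i |: L)); split; first exact: closure_flat.
  - exact: sub_closure.
  - by rewrite rank_closure // (rflatP rk _ cL).
  - by move=> K; apply: closure_sub.
have iH0 : i \in H0 by apply: (subsetP iLH0); rewrite !inE eqxx.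
have LH0 : L \subset H0 := subset_trans (subsetUr _ _) iLH0.
have aH0 : ~~ (a \subset H0).
  apply/negP => aH0; have : r (L :|: a) <= r H0 by rewrite rankS // subUset LH0.
  by rewrite rH0 leqNgt rLa.
have H0U : H0 \subset U.
  by apply: H0min; rewrite // subUset LU sub1set (subsetP aU).
have sandwich (K : {set T}) : L \subset K -> K \subset U ->
    {in s, forall F, (F \subset K) || (K \subset F)}.
  move=> LK KU F Fs; have Fs0 : F \in s0 by rewrite !inE Fs !orbT.
  have [aF|aF] := boolP (a \subset F).
    by rewrite (subset_trans KU (Umin _ Fs0 aF)) orbT.
  by rewrite (subset_trans (Lmax _ Fs0 aF) LK).
have pH0 : proper_flat r H0.
  apply/and3P; split=> //; first by apply/set0Pn; exists i.
  by apply: contraNneq aH0 => ->; apply: subsetT.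
have H0s : H0 \notin s.
  apply/negP => h; move/negP: iL; apply; apply: (subsetP (Lmax _ _ aH0)) iH0.
  by rewrite !inE h !orbT.
(* Otherwise [H0] would be a flat of the truncation comparable with the whole chain, hence a member
   of it by maximality. *)
have eH0 : r (H0 :|: a) = (r H0).+1.
  apply/eqP; apply: contraNT H0s => ne; apply: ms; last exact: sandwich.
  by rewrite proper_flat_truncE pH0.
(* The closure of [H0 :|: a] contains [a], so it survives truncation; lying between [L] and [U], it
   belongs to the completed chain, and minimality of [U] makes it [U]. *)
have rU : r U = (r H0).+1.
  rewrite -eH0 -(rank_closure rk (H0 :|: a)); congr r; set G := rclosure r _.
  have aG : a \subset G := subset_trans (subsetUr _ _) (sub_closure _ _).
  have GU : G \subset U by apply: closure_sub; rewrite // subUset H0U.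
  apply/eqP; rewrite eqEsubset GU andbT; apply: Umin => //.
  have [->|nT] := eqVneq G setT; first by rewrite !inE eqxx orbT.
  rewrite !inE; apply/or3P; apply: Or33; apply: ms; last first.
    apply: sandwich GU; apply: subset_trans LH0 _.
    exact: subset_trans (subsetUl _ _) (sub_closure _ _).
  apply/and3P; split=> //; last by apply: flat_trunc_sup => //; apply: closure_flat.
  by apply: contraNneq a0 => <-.
(* Such an [H] lies between [L] and [U] and contains [H0]; as [U] covers [H0] and is not [H], only
   [H = H0] remains. *)
have uH0 (H : {set T}) : proper_flat r H -> i \in H -> ~~ (a \subset H) ->
    {in s, forall F, (F \subset H) || (H \subset F)} -> H = H0.
  move=> /and3P[_ _ cH] iH aH /cmp0 cmpH.
  have LH : L \subset H.
    by case/orP: (cmpH _ Ls) => // HL; rewrite (subsetP HL) in iL.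
  have HU : H \subset U.
    by case/orP: (cmpH _ Us) => // UH; rewrite (subset_trans aU UH) in aH.
  have H0H : H0 \subset H by apply: H0min; rewrite // subUset sub1set iH.
  apply/esym/(flat_rank_eq rk) => //; rewrite -ltnS -rU ltnNge; apply/negP => h.
  by move: aH; rewrite (flat_rank_eq rk cH HU h) aU.
exists i, H0; split=> //; split=> [||F G|K pK cmpK].
- by rewrite /= H0s.
- rewrite /= pH0; apply/allP => F /(allP cs).
  by rewrite proper_flat_truncE => /andP[].
- have cH := sandwich _ LH0 H0U.
  rewrite !inE => /predU1P[->|Fs] /predU1P[->|Gs].
  + by rewrite subxx.
  + by rewrite orbC; apply: cH.
  + exact: cH.
  + exact: ts.
- have cmpKs : {in s, forall F, (F \subset K) || (K \subset F)}.
    by move=> F Fs; apply: cmpK; rewrite inE Fs orbT.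
  have [pK'|] := boolP (proper_flat (trunc r a) K).
    by rewrite inE ms ?orbT.
  rewrite proper_flat_truncE pK /= negbK => /eqP eK.
  have cK : rflat r K by case/and3P: pK.
  have aK : ~~ (a \subset K).
    by apply/negP => /setUidPl eaK; rewrite eaK in eK; apply: n_Sn eK.
  have [iK|iK] := boolP (i \in K).
    by rewrite (uH0 K) // mem_head.
  case/orP: (cmpK H0 (mem_head _ _)) => [H0K|KH0].
    by rewrite (subsetP H0K) in iK.
  (* [K] lies in [H0] but misses [i], so its rank is at most [r L] and [K \subset L]. Diminishing
     gains then force [r (L :|: a) <= (r L).+1], against [rLa]. *)
  have rK : r K <= r L.
    rewrite -ltnS -rH0 ltnNge; apply/negP => h.
    by rewrite (flat_rank_eq rk cK KH0 h) iH0 in iK.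
  have KL : K \subset L.
    case/orP: (cmp0 _ cmpKs _ Ls) => // LK.
    by rewrite (flat_rank_eq rk cL LK rK).
  have := rank_diminishing rk a KL.
  by rewrite eK addnS -addSn leq_add2r leqNgt rLa.
Qed.
End TruncFlats.

(** * The dragon Hall-Rado condition as a recursion *)

Fixpoint dhr (T : finType) (r : {set T} -> nat) (l : seq {set T}) : bool :=
  if l is a :: l' then (1 < r a)%N && dhr (trunc r a) l' else true.

(** Forwards, a list containing [a] gets its extra unit from [trunc_setU]. Backwards, [trunc r a]
    loses a unit on a union only when the union spans [a], and there the condition for [a :: s]
    gives it back. *)
Lemma dhrP (T : finType) (r : {set T} -> nat) (l : seq {set T}) : is_rank r ->
  dhr r l <->
  forall s, subseq s l -> s != [::] -> (size s < r (\bigcup_(a <- s) a))%N.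
Proof.
elim: l r => [|a l IH] r rk.
  by split=> // _ s; rewrite subseq0 => ->.
split=> [/= /andP[ra1] | h].
  have ra := ltnW ra1; move/(IH _ (trunc_is_rank rk ra)) => h [//|x s] /=.
  case: eqP => [-> sl _|_ sl _]; last first.
    exact: leq_trans (h _ sl isT) (trunc_le _ _ _).
  rewrite big_cons; have [->|s0] := eqVneq s [::]; first by rewrite big_nil setU0.
  rewrite setUC -(trunc_setU rk ra) ltnS.
  apply: leq_trans (h _ sl s0) _.
  have [_ mon _] := trunc_is_rank rk ra; exact/mon/subsetUl.
have ra1 : (1 < r a)%N.
  by have := h [:: a]; rewrite /= eqxx sub0seq big_seq1; apply.
have ra := ltnW ra1.
rewrite /= ra1; apply/(IH _ (trunc_is_rank rk ra)) => s sl s0.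
case: (truncP rk ra (\bigcup_(b <- s) b)) => [[e1 e2]|[_ ->]].
  have := h (a :: s); rewrite /= eqxx big_cons setUC e1 -e2 ltnS; exact.
by apply: h => //; apply: subseq_trans sl (subseq_cons _ _).
Qed.

Lemma DHRE (T : finType) (d : nat) (B : {set {set T}}) (A : 'I_d -> {set T}) :
  is_matroid B -> DHR B A = dhr (mrank B) [seq A k | k <- enum 'I_d].
Proof.
move=> mB; have dP := dhrP [seq A k | k <- enum 'I_d] (mrank_is_rank mB).
apply/forallP/idP => [h|/dP h J].
  apply/dP => s /subseqP[m sm ->].
  rewrite -map_mask; set e := mask m _ => e0.
  have ue : uniq e by rewrite mask_uniq ?enum_uniq.
  have := h [set k in e]; rewrite cardsE (card_uniqP ue) size_map big_map.
  have -> : \bigcup_(j in [set k in e]) A j = \bigcup_(j <- e) A j.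
    by rewrite big_uniq //; apply: eq_bigl => j; rewrite inE.
  move/implyP; apply; apply: contraNneq e0 => eJ.
  by rewrite -size_eq0 size_map -(card_uniqP ue) -cardsE eJ cards0.
apply/implyP => J0.
have -> : #|J| = size [seq A k | k <- enum J] by rewrite size_map -cardE.
have -> : \bigcup_(j in J) A j = \bigcup_(a <- [seq A k | k <- enum J]) a.
  by rewrite big_map big_enum.
apply: h; first by rewrite map_subseq // {1}/enum_mem -enumT filter_subseq.
by rewrite -size_eq0 size_map -cardE cards_eq0.
Qed.

(** * Iterated meets and their spanning sets *)

Section Meet.
Local Open Scope nat_scope.
Variable T : finType.
Implicit Types (r : {set T} -> nat) (X : {set T}) (l : seq {set T}).

Definition spanningr r : {set {set T}} := [set X | r X == r setT].

Definition meet_seq (fam : {set {set T}}) l : {set {set T}} :=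
  foldl (fun S a => meetf S (spanning (H_bases a))) fam l.

Lemma mem_spanning_H a X :
  (X \in spanning (H_bases a)) = [exists i in a, ~: [set i] \subset X].
Proof.
rewrite inE; apply/existsP/existsP => [[b /andP[/imsetP[i ia ->] bX]]|[i /andP[ia iX]]].
  by exists i; rewrite ia.
by exists (~: [set i]); rewrite iX andbT; apply/imsetP; exists i.
Qed.

Lemma spanning_U1E : spanning (U1_bases T) = [set X | X != set0].
Proof.
apply/setP => X; rewrite !inE; apply/existsP/set0Pn => [[b /andP[/imsetP[i _ ->]]]|[i iX]].
  by rewrite sub1set; exists i.
by exists [set i]; rewrite sub1set iX andbT; apply/imsetP; exists i.
Qed.

(** A spanning set of [H_bases a] misses at most one element, so each meet deletes at most one. *)
Lemma meet_seq_witness fam l X : X \in meet_seq fam l ->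
  exists2 S, S \in fam & #|S :\: X| <= size l.
Proof.
elim: l fam => [|a l IH] fam /=.
  by exists X; rewrite // setDv cards0.
move=> /IH[S /imset2P[S1 Y S1f]]; rewrite mem_spanning_H => /existsP[i /andP[_ iY]] ->.
move=> le; exists S1 => //; apply: leq_trans (_ : #|i |: (S1 :&: Y :\: X)| <= _).
  apply/subset_leq_card/subsetP => x; rewrite !inE => /andP[-> ->].
  by case: eqP => //= /eqP xi; rewrite (subsetP iY) // !inE.
rewrite cardsU1; case: (i \notin _) => /=; lia.
Qed.

(** A meet deletes at most one element, and that element lies in [a]. Conversely, a spanning set of
    the truncation either spans already or falls short by one, and then putting back some [i] in [a]
    that raises the rank makes it spanning. *)
Lemma meetf_spanningr r a : is_rank r -> 0 < r a ->
  meetf (spanningr r) (spanning (H_bases a)) = spanningr (trunc r a).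
Proof.
move=> rk ra.
have [i0 i0a] : exists i, i \in a.
  apply/set0Pn; apply: contraTneq ra => ->.
  by have := rank_card rk set0; rewrite cards0; lia.
have eT : (trunc r a setT).+1 = r setT.
  by case: (truncP rk ra setT); rewrite setTU; lia.
have mT X : r X <= r setT by rewrite rankS.
apply/setP => X; apply/imset2P/idP => [[S Y]|].
  rewrite inE => /eqP rS; rewrite mem_spanning_H => /existsP[i /andP[ia iY]] ->.
  set X' := S :&: Y; have S_iX : S \subset i |: X'.
    apply/subsetP => x xS; rewrite !inE xS; case: eqP => //= /eqP xi.
    by apply: (subsetP iY); rewrite !inE.
  have := rankU1 rk i X'; have := rankS rk S_iX.
  have : r (i |: X') <= r (X' :|: a) by rewrite rankS // setUC setUS // sub1set.
  have := mT (X' :|: a); have := mT X'.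
  by rewrite inE; case: (truncP rk ra X'); lia.
rewrite inE => /eqP e.
case: (truncP rk ra X) => [] [e1 e2].
  exists X setT; rewrite ?setIT //; first by rewrite inE; apply/eqP; lia.
  by rewrite mem_spanning_H; apply/existsP; exists i0; rewrite i0a subsetT.
have [i ia ri] : exists2 i, i \in a & r (i |: X) != r X.
  have [/existsP[i /andP[ia h]]|] := boolP [exists i in a, r (i |: X) != r X].
    by exists i.
  rewrite negb_exists => /forallP h; suff : r (X :|: a) = r X by lia.
  apply: rank_spanned => // i ia; apply/eqP.
  by have := h i; rewrite ia /= negbK.
have iX : i \notin X.
  by apply: contraNN ri => iX; apply/eqP; congr r; apply/setUidPr; rewrite sub1set.
exists (i |: X) (~: [set i]).
- rewrite inE; have := rankS rk (subsetUr [set i] X); have := mT (i |: X).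
  by move/eqP: ri; lia.
- by rewrite mem_spanning_H; apply/existsP; exists i; rewrite ia subxx.
- apply/setP => x; rewrite !inE; case: eqP => [->|_]; last by rewrite andbT.
  by rewrite (negbTE iX).
Qed.

Lemma meet_seq_dhr r l : is_rank r -> (forall x, r [set x] = 1) ->
  r setT = (size l).+1 -> all (fun a => a != set0) l ->
  (meet_seq (spanningr r) l = spanning (U1_bases T)) <-> dhr r l.
Proof.
elim: l r => [|a l IH] r rk ll rT /=.
  move=> _; split=> // _; rewrite spanning_U1E; apply/setP => X; rewrite !inE rT.
  have [->|/set0Pn[x xX]] := eqVneq X set0.
    by have := rank_card rk set0; rewrite cards0; lia.
  have : r [set x] <= r X by rewrite rankS // sub1set.
  by have := rankS rk (subsetT X); rewrite ll rT /=; lia.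
case/andP => /set0Pn[i ia] l0.
have ra : 0 < r a by rewrite -(ll i) rankS // sub1set.
have eT : trunc r a setT = (size l).+1.
  by case: (truncP rk ra setT); rewrite setTU rT /=; lia.
rewrite [meetf _ _]meetf_spanningr //; have rk' := trunc_is_rank rk ra.
have [ra1|ra1] := ltnP 1 (r a).
  apply: IH => // x; have := ll x; have := rankS rk (subsetUr [set x] a).
  by case: (truncP rk ra [set x]) => [] []; lia.
(* Now [r a = 1], so [i] is a loop of the truncation; deleting at most [size l] elements from a set
   of rank [(size l).+1] cannot leave [[set i]]. *)
split=> // e; exfalso.
have : [set i] \in spanning (U1_bases T).
  by rewrite spanning_U1E inE; apply/set0Pn; exists i; rewrite inE.
rewrite -e => /meet_seq_witness[S]; rewrite inE eT => /eqP rS le.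
have := rank_setD rk' S [set i].
have : [set i] :|: a = a by apply/setUidPr; rewrite sub1set.
case: (truncP rk ra [set i]) => [] [h1 h2] h3; rewrite h3 ?ll in h1 h2; lia.
Qed.
End Meet.

(** * Degree maps and products of the classes [h_a] *)

Section DegreeMaps.
Variables (R : comNzRingType) (n : nat).
Notation T := 'I_n.+1.
Implicit Types (r : {set T} -> nat) (phi : seq {set T} -> R) (a F G H : {set T}).

(* Unlike [is_degree_map], [phi] is required to vanish off the proper flats, so
   that all sums range over all subsets and [phi] need not be restricted when
   [r] is truncated. *)
Definition degree_map r (d : nat) phi : Prop :=
  [/\ forall s t, size s = d -> perm_eq s t -> phi s = phi t,
      forall s F, size s = d -> F \in s -> ~~ proper_flat r F -> phi s = 0,
      forall s F G, size s = d -> F \in s -> G \in s ->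
        ~~ (F \subset G) -> ~~ (G \subset F) -> phi s = 0,
      forall (i j : T) t, (size t).+1 = d ->
        \sum_(F : {set T} | i \in F) phi (F :: t) =
        \sum_(F : {set T} | j \in F) phi (F :: t) &
      forall s, size s = d -> saturated r s -> phi s = 1].

(* The functional [x_s |-> phi (h_a * x_s)]. *)
Definition cap_h a phi (s : seq {set T}) : R :=
  \sum_(F : {set T}) h_coef R a F * phi (F :: s).

Fixpoint chow_eval_seq (l : seq {set T}) phi : R :=
  if l is a :: l' then chow_eval_seq l' (cap_h a phi) else phi [::].

Lemma chow_eval_seq0 l phi :
  (forall s, size s = size l -> phi s = 0) -> chow_eval_seq l phi = 0.
Proof.
elim: l phi => [|a l IH] phi h /=; first exact: h.
by apply: IH => s es; apply: big1 => F _; rewrite h ?mulr0 //= es.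
Qed.

(** The linear relations allow [alpha] to be written with [i] instead of [ord0]; since [i \in a],
    the terms over sets containing [a] cancel. *)
Lemma cap_hE r d phi a i t : degree_map r d phi -> (size t).+1 = d -> i \in a ->
  cap_h a phi t = \sum_(F : {set T} | (i \in F) && ~~ (a \subset F)) phi (F :: t).
Proof.
move=> [_ _ _ lin _] td ia.
have -> : cap_h a phi t = \sum_(F : {set T} | (ord0 : T) \in F) phi (F :: t)
    - \sum_(F : {set T} | a \subset F) phi (F :: t).
  rewrite [X in _ = X - _]big_mkcond [X in _ = _ - X]big_mkcond -sumrB; apply: eq_bigr => F _.
  rewrite /h_coef; do 2!case: ifP => _;
  by rewrite ?subr0 ?sub0r ?subrr ?mul0r ?mul1r ?mulN1r.
rewrite (lin _ i) // (bigID (fun F => a \subset F)) /= addrAC.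
rewrite [X in X - _](eq_bigl (fun F => a \subset F)) ?subrr ?add0r // => F.
by rewrite andb_idl // => /subsetP; apply.
Qed.

Lemma cap_h_degree_map r d phi a : is_rank r -> (forall x, r [set x] = 1%N) ->
  (1 < r a)%N -> degree_map r d.+1 phi -> degree_map (trunc r a) d (cap_h a phi).
Proof.
move=> rk ll ra1 dphi; have ra := ltnW ra1.
have [sym nflat inc lin sat] := dphi.
have nflat' s F : size s = d -> F \in s -> ~~ proper_flat (trunc r a) F ->
    cap_h a phi s = 0.
  move=> sd Fs; rewrite proper_flat_truncE // negb_and.
  have [pF /=|pF _] := boolP (proper_flat r F); last first.
    apply: big1 => H _; rewrite (nflat _ F) ?mulr0 //= ?sd //.
    by rewrite inE Fs orbT.
  rewrite negbK => /eqP eF.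
  (* [F] is a flat lost in the truncation. A flat [H] that contains [i] and is comparable with [F]
     must contain [F], and then [cover_absorb] gives [a \subset H], which the sum in [cap_hE]
     excludes. *)
  have /subsetPn[i ia iF] : ~~ (a \subset F).
    by apply/negP => /setUidPl eFa; rewrite eFa in eF; apply: n_Sn eF.
  rewrite (cap_hE dphi _ ia) ?sd //; apply: big1 => H /andP[iH aH].
  have szH : size (H :: s) = d.+1 by rewrite /= sd.
  have [pH|pH] := boolP (proper_flat r H); last first.
    by apply: (nflat _ H) => //; apply: mem_head.
  have FHs : F \in H :: s by rewrite inE Fs orbT.
  apply: (inc _ H F szH (mem_head _ _) FHs).
    by apply: contraNN iF => /subsetP; apply.
  have /and3P[_ _ cF] := pF; have /and3P[_ _ cH] := pH.
  by apply: contraNN aH; apply: (cover_absorb rk cF cH eF ia iF iH).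
split=> //.
- move=> s t sd st; apply: eq_bigr => F _.
  by congr (_ * _); apply: sym; rewrite /= ?sd // perm_cons.
- move=> s F G sd Fs Gs FG GF; apply: big1 => H _.
  by rewrite (inc _ F G) ?mulr0 //= ?sd // inE ?Fs ?Gs orbT.
(* Exchanging the two sums and the two leading factors reduces this to the linear relation for [phi]
   at [H :: t]. *)
- move=> i j t td; rewrite /cap_h ![\sum_(_ | _ \in _) _]exchange_big /=.
  apply: eq_bigr => H _; rewrite -!mulr_sumr; congr (_ * _).
  have swap F : phi [:: H, F & t] = phi [:: F, H & t].
    by apply: sym; rewrite /= ?td //; exact: permEl (perm_catCA [:: H] [:: F] t).
  under eq_bigr do rewrite swap; under [RHS]eq_bigr do rewrite swap.
  by apply: lin; rewrite /= td.
- move=> s sd ss.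
  have [i [H0 [ia iH0 aH0 sat0 uniq0]]] := saturated_lift rk ra ll ra1 ss.
  have sz0 : size (H0 :: s) = d.+1 by rewrite /= sd.
  rewrite (cap_hE dphi _ ia) ?sd // (bigD1 H0) ?iH0 //= big1 ?addr0.
    exact: sat.
  move=> H /andP[/andP[iH aH] /eqP nH].
  have szH : size (H :: s) = d.+1 by rewrite /= sd.
  have [pH|pH] := boolP (proper_flat r H); last first.
    by apply: (nflat _ H) => //; apply: mem_head.
  have [/allP cmp|/allPn[F Fs]] :=
      boolP (all (fun F : {set T} => (F \subset H) || (H \subset F)) s).
    by case: nH; apply: uniq0.
  rewrite negb_or => /andP[FH HF].
  by apply: (inc _ F H) => //; rewrite inE ?Fs ?eqxx ?orbT.
Qed.

Lemma chow_eval_seq_dhr r l phi : is_rank r -> (forall x, r [set x] = 1%N) ->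
  r setT = (size l).+1 -> all (fun a => a != set0) l ->
  degree_map r (size l) phi -> chow_eval_seq l phi = if dhr r l then 1 else 0.
Proof.
elim: l r phi => [|a l IH] r phi rk ll rT /=.
  (* At rank one every nonempty flat is the whole ground set, so the empty chain is maximal. *)
  move=> _ [_ _ _ _ sat]; apply: sat => //; split=> // G /and3P[G0 GT cG] _.
  case/eqP: GT; apply: (flat_rank_eq rk cG (subsetT G)).
  by case/set0Pn: G0 => x xG; rewrite rT -(ll x) rankS // sub1set.
case/andP => /set0Pn[i ia] l0 dphi.
have ra : (0 < r a)%N by rewrite -(ll i) rankS // sub1set.
have [ra1|ra1] /= := ltnP 1 (r a).
  apply: IH => //; last exact: cap_h_degree_map.
  - exact: trunc_is_rank.
  - move=> x; have := ll x; have := rankS rk (subsetUr [set x] a).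
    by case: (truncP rk ra [set x]) => [] []; lia.
  - by case: (truncP rk ra setT); rewrite setTU rT /=; lia.
(* Now [r a = 1]: every flat containing [i] contains [a], so no term of [cap_hE] survives. *)
apply: chow_eval_seq0 => s sl; rewrite (cap_hE dphi _ ia) ?sl //.
apply: big1 => F /andP[iF aF]; have [_ nflat _ _ _] := dphi.
apply: (nflat _ F); rewrite /= ?sl ?mem_head //; apply: contraNN aF => /and3P[_ _ cF].
apply: (flat_absorb rk cF); apply: (rank_spanned_mono rk (X := [set i])).
  by rewrite sub1set.
have -> : [set i] :|: a = a by apply/setUidPr; rewrite sub1set.
by rewrite ll; apply/eqP; rewrite eqn_leq ra1.
Qed.

Lemma sum_ffunS (d : nat) (X : finType) (g : {ffun 'I_d.+1 -> X} -> R) :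
  \sum_f g f = \sum_(f : {ffun 'I_d -> X}) \sum_(x : X)
    g [ffun k => if unlift ord0 k is Some j then f j else x].
Proof.
rewrite pair_bigA /=.
rewrite (reindex (fun p : {ffun 'I_d -> X} * X =>
  [ffun k => if unlift ord0 k is Some j then p.1 j else p.2])) //=.
exists (fun f => ([ffun j => f (lift ord0 j)], f ord0)) => [[f x] _|f _] /=.
  congr (_, _); last by rewrite ffunE unlift_none.
  by apply/ffunP => j; rewrite !ffunE liftK.
apply/ffunP => k; rewrite ffunE; case: unliftP => [j ->|->] //=.
by rewrite ffunE.
Qed.

Lemma chow_eval_seqE d (A : 'I_d -> {set T}) phi :
  \sum_(f : {ffun 'I_d -> {set T}})
     (\prod_(k < d) h_coef R (A k) (f k)) * phi [seq f k | k <- enum 'I_d] =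
  chow_eval_seq [seq A k | k <- enum 'I_d] phi.
Proof.
elim: d A phi => [|d IH] A phi.
  have e0 : enum 'I_0 = [::] by apply: size0nil; rewrite size_enum_ord.
  rewrite e0 /= (big_pred1 [ffun k : 'I_0 => set0 : {set T}]) => [|f].
    by rewrite big_ord0 mul1r.
  by apply/esym/eqP/ffunP => -[].
rewrite sum_ffunS enum_ordSl /= -map_comp -IH; apply: eq_bigr => f _.
rewrite /cap_h mulr_sumr; apply: eq_bigr => F _.
rewrite big_ord_recl ffunE unlift_none mulrCA mulrA; congr (_ * _ * phi _).
  by apply: eq_bigr => k _; rewrite ffunE liftK.
by rewrite -map_comp; congr (_ :: _); apply: eq_map => k /=; rewrite ffunE liftK.
Qed.
End DegreeMaps.

(** * Transfer to the stated degree maps, and conclusion *)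

Lemma degree_map_extend (R : comNzRingType) (n d : nat) (B : {set {set 'I_n.+1}})
    (phi : seq {set 'I_n.+1} -> R) : is_degree_map d B phi ->
  degree_map (mrank B) d (fun s => if all (nepflat B) s then phi s else 0).
Proof.
case=> sym inc lin chain; split.
- move=> s t sd st; rewrite -(perm_all _ st); case: ifP => // ps; exact: sym.
- move=> s F _ Fs pF; case: ifP => // /allP/(_ F Fs) pF'.
  by case/negP: pF.
- move=> s F G sd Fs Gs FG GF; case: ifP => // ps.
  by apply: inc => //; exists F, G.
- move=> i j t td /=; have [pt|pt] := boolP (all (nepflat B) t); last first.
    by rewrite !big1 // => F _; rewrite andbF.
  have E k : \sum_(F : {set 'I_n.+1} | k \in F)
      (if nepflat B F && true then phi (F :: t) else 0) =
      \sum_(F : {set 'I_n.+1} | nepflat B F && (k \in F)) phi (F :: t).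
    by rewrite [RHS]big_mkcondl; apply: eq_bigr => F _; rewrite andbT.
  by rewrite !E; apply: lin.
- move=> s sd [us ps ts ms]; rewrite [all _ _]ps.
  (* Sorting by inclusion turns the unordered chain into an increasing one: pairwise comparability
     makes the sort correct and [uniq] makes it strict. *)
  pose sub (F G : {set 'I_n.+1}) := F \subset G; pose s' := sort sub s.
  have s's : perm_eq s' s by rewrite perm_sort.
  have mem_s' F : (F \in s') = (F \in s) by rewrite mem_sort.
  rewrite (sym _ s' sd ps) 1?perm_sym //; apply: chain; first by rewrite size_sort.
  split; first by rewrite all_sort.
    have sub_tr : transitive sub by move=> F G H; apply: subset_trans.
    apply: pairwise_sorted; apply: (sub_pairwise (r := [rel F G | (F != G) && sub F G])).
      by move=> F G /=; rewrite properEneq.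
    rewrite pairwise_relI -uniq_pairwise sort_uniq us -sorted_pairwise //.
    exact: (@sort_sorted_in _ (mem s) sub) ts _ (allss s).
  by move=> G pG h; rewrite mem_s'; apply: ms => // F Fs; apply: h; rewrite mem_s'.
Qed.

Theorem theorem5p10 (R : realFieldType) (n d : nat)
    (B : {set {set 'I_n.+1}}) (A : 'I_d -> {set 'I_n.+1}) :
  is_matroid B -> loopless B -> mrank B setT = d.+1 ->
  (forall k, A k != set0) ->
  (meet_all B A = spanning (U1_bases 'I_n.+1) <-> DHR B A) /\
  (forall phi : seq {set 'I_n.+1} -> R, is_degree_map d B phi ->
     chow_eval B phi (fun k F => h_coef R (A k) F) = if DHR B A then 1 else 0).
Proof.
move=> mB ll rT A0; have rk := mrank_is_rank mB.
set l := [seq A k | k <- enum 'I_d].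
have sl : size l = d by rewrite size_map size_enum_ord.
have l0 : all (fun a => a != set0) l by apply/allP => _ /mapP[k _ ->].
rewrite DHRE //; split=> [|phi dphi].
  rewrite -meet_seq_dhr ?sl //.
  have -> : meet_all B A = meet_seq (spanning B) l.
    by rewrite /meet_all /l; elim: (enum _) (spanning B) => //= k e IH S; apply: IH.
  suff -> : spanning B = spanningr (mrank B) by [].
  by apply/setP => X; rewrite spanningE // inE.
(* [phi'] vanishes off the proper flats, which removes the restriction on [f] in [chow_eval]. *)
have := degree_map_extend dphi; set phi' := fun s => _; move=> dphi'.
rewrite -(@chow_eval_seq_dhr _ _ (mrank B) l phi') ?sl // -chow_eval_seqE /chow_eval.
rewrite big_mkcond; apply: eq_bigr => f _; rewrite /phi' all_map.
have -> : all (preim f (nepflat B)) (enum 'I_d) = [forall k, nepflat B (f k)].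
  apply/allP/forallP => h k; last by move=> _; apply: h.
  by apply: h; rewrite mem_enum.
by case: ifP; rewrite ?mulr0.
Qed.
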